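(* For all integers $r \ge 1$ and $s \ge t \ge 2$, we have $R_r^{KG}(s,t) \ge sr + (t-2)(s-1)$.
   Context: For positive integers $n$ and $r$, the Kneser graph $KG(n,r)$ is the graph whose vertices are the $r$-element subsets of $[n]=\{1,\dots,n\}$, two vertices being adjacent precisely when the corresponding sets are disjoint. The $r$-Kneser Ramsey number $R_r^{KG}(s,t)$ is the minimum integer $n$ such that every red/blue coloring of the edges of $KG(n,r)$ contains a red copy of the complete graph $K_s$ (all of whose edges are red) or a blue copy of the complete graph $K_t$ (all of whose edges are blue). *)

(* Defs.v *)
From HB Require Import structures.
From mathcomp Require Import all_boot.

Set Implicit Arguments.
Unset Strict Implicit.
Unset Printing Implicit Defensive.

Section Graph.

Variables (V : finType) (e : rel V).

Definition edge_set : {set {set V}} :=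
  [set [set p.1; p.2] | p : V * V & e p.1 p.2].

Definition edge : finType := {f : {set V} | f \in edge_set}.

Definition clique (S : {set V}) : bool :=
  [forall x in S, forall y in S, (x != y) ==> e x y].

(* A red/blue colouring of the edges; [true] is red and [false] is blue. *)
Definition coloring : finType := {ffun edge -> bool}.

(* A copy of K_k all of whose edges have colour [b], given by its vertex set. *)
Definition has_mono_complete (c : coloring) (b : bool) (k : nat) : bool :=
  [exists S : {set V}, [&& #|S| == k, clique S &
    [forall f : edge, (val f \subset S) ==> (c f == b)]]].

Definition arrows (s t : nat) : bool :=
  [forall c : coloring, has_mono_complete c true s || has_mono_complete c false t].

End Graph.

(* The ground set [n] is rendered as 'I_n = {0, ..., n - 1}. *)
Definition kneser_vertex (n r : nat) : finType := {A : {set 'I_n} | #|A| == r}.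

(* Irreflexive only for 0 < r, the case of interest. *)
Definition kneser (n r : nat) : rel (kneser_vertex n r) :=
  fun A B => [disjoint val A & val B].

Definition homog (V : finType) (c : rel V) (b : bool) (R : {set V}) : Prop :=
  {in R &, forall x y, x != y -> c x y = b}.

Lemma homogU1 (V : finType) (c : rel V) b x (R : {set V}) :
  symmetric c -> {in R, forall y, c x y = b} -> homog c b R ->
  homog c b (x |: R).
Proof.
move=> sc xR hR u v; rewrite !inE => /predU1P[->|uR] /predU1P[->|vR] nuv.
- by rewrite eqxx in nuv.
- exact: xR.
- by rewrite sc xR.
- exact: hR.
Qed.

Lemma ramsey_exp (V : finType) (c : rel V) (k s t : nat) (S : {set V}) :
  symmetric c -> s + t = k -> 2 ^ k <= #|S| ->
  exists2 R : {set V}, R \subset S &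
    (#|R| = s /\ homog c true R) \/ (#|R| = t /\ homog c false R).
Proof.
move=> sc; elim: k s t S => [|k IHk] s t S.
  move/eqP; rewrite addn_eq0 => /andP[/eqP-> _] _.
  by exists set0; [exact: sub0set | left; split; [exact: cards0 | move=> x y; rewrite inE]].
case: s => [|s] stk leS.
  by exists set0; [exact: sub0set | left; split; [exact: cards0 | move=> x y; rewrite inE]].
case: t stk => [|t] stk.
  by exists set0; [exact: sub0set | right; split; [exact: cards0 | move=> x y; rewrite inE]].
have /card_gt0P[x xS] : 0 < #|S| by apply: leq_trans leS; rewrite expn_gt0.
pose N := [set y in S :\ x | c x y]; pose M := [set y in S :\ x | ~~ c x y].
have cardNM : #|N| + #|M| = #|S|.-1.
  rewrite (cardsD1 x S) xS add1n /= -[in RHS](cardsID N (S :\ x)).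
  congr (_ + _); apply: eq_card => y; rewrite !inE.
    by case: (c x y); case: (y == x); case: (y \in S).
  by case: (c x y); case: (y == x); case: (y \in S).
have step b (T : {set V}) (R : {set V}) : T \subset S :\ x ->
    {in T, forall y, c x y = b} -> R \subset T -> homog c b R ->
    [/\ x |: R \subset S, #|x |: R| = #|R|.+1 & homog c b (x |: R)].
  move=> TS Tb RT hR; have RS := subset_trans RT TS; split.
  - by rewrite subUset sub1set xS (subset_trans RS) // subsetDl.
  - by rewrite cardsU1; case: (boolP (x \in R)) => // /(subsetP RS); rewrite !inE eqxx.
  - by apply: homogU1 => // y /(subsetP RT)/Tb.
have NS : N \subset S :\ x by apply/subsetP => y; rewrite inE => /andP[].
have MS : M \subset S :\ x by apply/subsetP => y; rewrite inE => /andP[].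
have SxS : S :\ x \subset S by rewrite subsetDl.
have [leN|ltN] := leqP (2 ^ k) #|N|.
  have [|R RN [[sR hR]|[sR hR]]] := IHk s t.+1 N _ leN; first by case: stk.
    have [|h1 h2 h3] := step true N R NS _ RN hR; first by move=> y; rewrite inE => /andP[].
    by exists (x |: R) => //; left; rewrite h2 sR.
  by exists R; [exact: subset_trans RN (subset_trans NS SxS) | right].
have leM : 2 ^ k <= #|M|.
  rewrite leqNgt; apply/negP => ltM.
  have := leq_add ltN ltM; rewrite addSn addnS cardNM addnn -mul2n -expnS.
  have S_gt0 : 0 < #|S| by apply/card_gt0P; exists x.
  by rewrite prednK // ltnNge leS.
have [|R RM [[sR hR]|[sR hR]]] := IHk s.+1 t M _ leM.
- by move: stk; rewrite addnS => -[].
- by exists R; [exact: subset_trans RM (subset_trans MS SxS) | left].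
have [|h1 h2 h3] := step false M R MS _ RM hR.
  by move=> y; rewrite inE => /andP[_ /negbTE].
by exists (x |: R) => //; right; rewrite h2 sR.
Qed.

Lemma arrows_clique (V : finType) (e : rel V) (s t : nat) (S : {set V}) :
  irreflexive e -> clique e S -> 2 ^ (s + t) <= #|S| -> arrows e s t.
Proof.
move=> irr clS leS; apply/forallP => c.
pose d : rel V := fun x y => [exists f : edge e, (val f == [set x; y]) && c f].
have sd : symmetric d by move=> x y; apply: eq_existsb => f; rewrite setUC.
have cl (R : {set V}) : R \subset S -> clique e R.
  move=> /subsetP RS; apply/forall_inP => x /RS xS; apply/forall_inP => y /RS yS.
  by have /forall_inP/(_ x xS)/forall_inP/(_ y yS) := clS.
have mono b (R : {set V}) : homog d b R ->
    [forall f : edge e, (val f \subset R) ==> (c f == b)].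
  move=> hR; apply/forallP => f; apply/implyP => fR.
  have /imsetP[[x y]] := valP f; rewrite inE /= => exy f_xy.
  have {f_xy} fE : val f = [set x; y] by [].
  have nxy : x != y by apply: contraTneq exy => ->; rewrite irr.
  move: fR; rewrite fE subUset !sub1set => /andP[xR yR].
  rewrite -(hR x y xR yR nxy); apply/eqP.
  apply/idP/existsP => [cf|[g /andP[/eqP gE cg]]].
    by exists f; rewrite fE eqxx.
  by suff -> : f = g by []; apply: val_inj; rewrite fE gE.
have [R RS [[sR hR]|[sR hR]]] := ramsey_exp sd (erefl (s + t)) leS.
  by apply/orP; left; apply/existsP; exists R; rewrite sR eqxx cl ?mono.
by apply/orP; right; apply/existsP; exists R; rewrite sR eqxx cl ?mono.
Qed.

(* Finite Ramsey, applied to consecutive disjoint blocks of size r. *)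
Lemma kneser_arrows_ex (r s t : nat) :
  0 < r -> exists n, arrows (@kneser n r) s t.
Proof.
move=> r_gt0; pose N := 2 ^ (s + t); exists (N * r).
pose B (i : 'I_N) : {set 'I_(N * r)} := [set x : 'I_(N * r) | x %/ r == i].
have ltij (i : 'I_N) (j : 'I_r) : i * r + j < N * r.
  apply: (@leq_trans (i.+1 * r)); last by rewrite leq_mul2r ltn_ord orbT.
  by rewrite mulSn addnC ltn_add2r.
have cardB i : #|B i| == r.
  have inj : injective (fun j : 'I_r => Ordinal (ltij i j)).
    by move=> j k /(congr1 val) /= /addnI /val_inj.
  rewrite -[X in _ == X]card_ord -(card_imset _ inj); apply/eqP/eq_card => x.
  rewrite inE; apply/eqP/imsetP => [xi|[j _ ->] /=].
    exists (Ordinal (ltn_pmod x r_gt0)) => //.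
    by apply: val_inj; rewrite /= -xi -divn_eq.
  by rewrite divnMDl // divn_small ?addn0.
pose b i : kneser_vertex (N * r) r := exist _ (B i) (cardB i).
have disB i j : i != j -> [disjoint B i & B j].
  move=> nij; rewrite -setI_eq0; apply/eqP/setP => x; rewrite !inE.
  by apply: contraNF nij => /andP[/eqP xi /eqP xj]; apply/eqP/val_inj; rewrite /= -xi.
have binj : injective b.
  move=> i j bij; apply/eqP; apply: contraT => /disB.
  have -> : B i = B j by exact: (congr1 val bij).
  by rewrite -setI_eq0 setIid -cards_eq0 (eqP (cardB j)) (gtn_eqF r_gt0).
apply: (@arrows_clique _ _ s t (b @: setT)).
- move=> A; rewrite /kneser /= -setI_eq0 setIid -cards_eq0.
  by rewrite (eqP (valP A)) (gtn_eqF r_gt0).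
- apply/forall_inP => _ /imsetP[i _ ->]; apply/forall_inP => _ /imsetP[j _ ->].
  by apply/implyP => nij; apply: disB; apply: contraNneq nij => ->.
by rewrite card_imset // cardsT card_ord.
Qed.

Definition kneser_ramsey (r s t : nat) (r_gt0 : 0 < r) : nat :=
  ex_minn (kneser_arrows_ex s t r_gt0).

Arguments kneser_ramsey : clear implicits.

(* Main.v *)
(** Split the [n <= s * r - 1 + (t - 2) * (s - 1)] points into one block of at
    most [s * r - 1] consecutive points followed by [t - 2] blocks of at most
    [s - 1] points, and put an [r]-set in the class of the last block it meets.
    Colour an edge red when its ends lie in the same class.  A blue clique has
    at most one vertex in each of the [t - 1] classes.  The vertices of a red
    clique are disjoint sets of the same class: in class 0 they all lie inside
    the first block, in any other class each uses up a point of the same block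
    of size [s - 1]; either way there are fewer than [s] of them. *)
Require Import Defs.
From mathcomp Require Import all_boot.
From mathcomp Require Import zify.

(** With red meaning equal [h]-values, [h] is constant on a red clique and injective on a blue
    one. *)
Lemma not_arrows_classes (V : finType) (e : rel V) (s t k : nat)
    (h : V -> 'I_k) :
  k < t ->
  (forall S : {set V}, clique e S -> {in S &, forall x y, h x = h y} ->
     #|S| < s) ->
  ~~ arrows e s t.
Proof.
move=> ltkt redS; apply/negP => /forallP.
(* An edge is an unordered set, so its colour compares [h] on all pairs of members, with no choice
   of ends. *)
move/(_ [ffun f : edge e => [forall x in val f, forall y in val f, h x == h y]]).
have mono b (S : {set V}) : clique e S ->
    [forall f : edge e, (val f \subset S) ==>
      ([ffun f : edge e =>
          [forall x in val f, forall y in val f, h x == h y]] f == b)] ->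
    {in S &, forall x y, x != y -> (h x == h y) = b}.
  move=> /forall_inP clS /forallP cS x y xS yS nxy.
  have exy : e x y by have /forall_inP/(_ y yS)/implyP/(_ nxy) := clS x xS.
  have fP : [set x; y] \in edge_set e.
    by apply/imsetP; exists (x, y); rewrite ?inE.
  have := cS (exist _ [set x; y] fP).
  rewrite ffunE /= subUset !sub1set xS yS /= => /eqP <-.
  apply/eqP/forall_inP => [hxy u|/(_ x)].
    rewrite !inE => u_xy; apply/forall_inP => v; rewrite !inE => v_xy.
    by case/orP: u_xy => /eqP->; case/orP: v_xy => /eqP->; rewrite ?hxy.
  rewrite !inE eqxx => /(_ isT)/forall_inP/(_ y).
  by rewrite !inE eqxx orbT => /(_ isT)/eqP.
case/orP => /existsP[S /and3P[/eqP cardS clS /(mono _ _ clS) hS]].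
  have /(redS S clS) : {in S &, forall x y, h x = h y}.
    move=> x y xS yS; have [->//|nxy] := eqVneq x y.
    exact/eqP/hS.
  by rewrite cardS ltnn.
have inj : {in S &, injective h}.
  move=> x y xS yS hxy; apply/eqP/negPn/negP => nxy.
  by have := hS x y xS yS nxy; rewrite hxy eqxx.
have := max_card (mem (h @: S)).
by rewrite card_in_imset // cardS card_ord leqNgt ltkt.
Qed.

(** Double counting of incidences: members of a clique are pairwise disjoint, so each point of [P]
    lies in at most one of them. *)
Lemma kneser_clique_trace (n r : nat) (S : {set kneser_vertex n r})
    (P : {set 'I_n}) (d : nat) :
  clique (@kneser n r) S -> {in S, forall A, d <= #|val A :&: P|} ->
  #|S| * d <= #|P|.
Proof.
move=> /forall_inP clS leS; rewrite -sum_nat_const.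
apply: (@leq_trans (\sum_(A in S) \sum_(x in P) (x \in val A))).
  apply: leq_sum => A /leS/leq_trans; apply.
  rewrite -sum1_card -big_mkcondr eq_leq //.
  by apply: eq_bigl => x; rewrite inE andbC.
rewrite exchange_big /= -sum1_card leq_sum // => x _.
rewrite -big_mkcondr sum1_card; apply/card_le1_eqP => A B.
move=> /andP[AS xA] /andP[BS xB]; apply/eqP/negPn/negP => nAB.
have /forall_inP/(_ A AS)/implyP/(_ nAB) := clS B BS.
by move=> /disjointFr/(_ xB); rewrite xA.
Qed.

Lemma card_ord_interval (n a b : nat) :
  #|[set x : 'I_n | a <= x < a + b]| <= b.
Proof.
rewrite -[leqRHS](size_iota a) cardE -(size_map val).
apply: uniq_leq_size; first by rewrite map_inj_uniq ?enum_uniq //; exact: val_inj.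
by move=> _ /mapP[x + ->]; rewrite mem_enum inE mem_iota.
Qed.

Theorem theorem1p4 (r s t : nat) (r_ge1 : 1 <= r) :
  2 <= t -> t <= s ->
  s * r + (t - 2) * (s - 1) <= kneser_ramsey r s t r_ge1.
Proof.
move=> t_ge2 le_ts; rewrite /kneser_ramsey; case: ex_minnP => n arr _.
rewrite leqNgt; apply/negP => ltn; move: arr; apply/negP.
pose blk (x : 'I_n) :=
  if x < s * r - 1 then 0 else ((x - (s * r - 1)) %/ (s - 1)).+1.
have blk_le x : blk x <= t - 2.
  (* The bound on [n] gives [x - (s * r - 1) < (t - 2) * (s - 1)]. *)
  rewrite /blk; case: ltnP => // le_x; rewrite ltn_divLR; last by lia.
  by have := ltn_ord x; lia.
have card_blk0 : #|[set x | blk x == 0]| <= s * r - 1.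
  apply: leq_trans (card_ord_interval n 0 _).
  by apply/subset_leq_card/subsetP => x; rewrite !inE /blk; case: ltnP.
have card_blkS m : #|[set x | blk x == m.+1]| <= s - 1.
  apply: leq_trans (card_ord_interval n (s * r - 1 + m * (s - 1)) _).
  apply/subset_leq_card/subsetP => x; rewrite !inE /blk; case: ltnP => // le_x.
  rewrite eqSS => /eqP <-; have s1_gt0 : 0 < s - 1 by lia.
  have := divn_eq (x - (s * r - 1)) (s - 1).
  by have := ltn_pmod (x - (s * r - 1)) s1_gt0; lia.
pose cls (A : kneser_vertex n r) := \max_(x in val A) blk x.
have cls_le A : cls A <= t - 2 by apply/bigmax_leqP.
apply: (@not_arrows_classes _ _ _ _ (t - 2).+1 (fun A => inord (cls A))).
  by lia.
move=> S clS eqS; have [->|[A0 A0S]] := set_0Vmem S; first by rewrite cards0; lia.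
have eq_cls A : A \in S -> cls A = cls A0.
  (* [inord] loses nothing here, since [cls_le] keeps the classes in range. *)
  by move=> AS; have /(congr1 val) := eqS A A0 AS A0S; rewrite /= !inordK ?ltnS.
case m_eq: (cls A0) eq_cls => [|m] eq_cls.
  have : #|S| * r <= #|[set x | blk x == 0]|.
    (* A maximum of 0 puts every point of [A] in block 0, so the trace is all of [A]. *)
    apply: kneser_clique_trace clS _ => A AS; rewrite -{1}(eqP (valP A)).
    apply/subset_leq_card/subsetP => x xA; move: (xA); rewrite !inE => -> /=.
    by rewrite -leqn0 -(eq_cls A AS) leq_bigmax_cond.
  by rewrite -(ltn_pmul2r r_ge1); nia.
have : #|S| * 1 <= #|[set x | blk x == m.+1]|.
  apply: kneser_clique_trace clS _ => A AS; rewrite card_gt0; apply/set0Pn.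
  (* As [r > 0], the maximum is attained: [A] really meets block [m.+1]. *)
  have A_gt0 : 0 < #|val A| by rewrite (eqP (valP A)).
  have [x xA cls_x] := eq_bigmax_cond blk A_gt0.
  by exists x; rewrite !inE xA /= -cls_x -(eq_cls A AS).
by have := card_blkS m; lia.
Qed.
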